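(* Let $k,l$ be integers with $0\le l<k\le n$. Let $\Omega\subset\mathbb H^n$ be a bounded $C^2$ domain in hyperbolic space with unit outer normal $\gamma$ to $\partial\Omega$, and let $u\in C^3(\Omega)\cap C^2(\overline\Omega)$ satisfy $$S_k(D^2u-uI)=\frac{C_n^k}{C_n^l}\,S_l(D^2u-uI)\ \text{ in }\Omega,\qquad u=0\ \text{ on }\partial\Omega,\qquad \frac{\partial u}{\partial\gamma}=1\ \text{ on }\partial\Omega.$$ Assume that $S_l(D^2u-uI)>0$ in $\overline\Omega$. Then there exist a point $p\in\mathbb H^n$ and $R>0$ with $\tanh R=1$ such that $\Omega$ is the geodesic ball of radius $R$ centered at $p$ and $u=\frac{\cosh r}{\cosh R}-1$ in $\Omega$, where $r$ denotes the hyperbolic distance from $p$.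
   Context: $\mathbb H^n$ is the $n$-dimensional hyperbolic space of constant sectional curvature $-1$. A domain is a connected open set. $D^2u$ is the (covariant) Hessian of $u$ with respect to the hyperbolic metric and $I$ is the identity (the metric), so that $D^2u-uI$ is, in a local orthonormal frame, the symmetric matrix with entries $u_{ij}-u\delta_{ij}$. $C_n^m=\binom nm$. For a real symmetric $n\times n$ matrix $A$ with eigenvalues $\lambda_1,\dots,\lambda_n$ and $1\le m\le n$, $S_m(A)=\sum_{1\le i_1<\cdots<i_m\le n}\lambda_{i_1}\cdots\lambda_{i_m}$, and $S_0(A)=1$. *)

(* Defs.v *)
From HB Require Import structures.
From mathcomp Require Import all_boot all_order all_algebra.
From mathcomp Require Import all_classical all_reals all_analysis.

Set Implicit Arguments.
Unset Strict Implicit.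
Unset Printing Implicit Defensive.

Import Order.TTheory GRing.Theory Num.Theory.
Import numFieldNormedType.Exports.

Local Open Scope classical_set_scope.
Local Open Scope ring_scope.

Section Hyperbolic_functions.
Variable R : realType.
Implicit Type t : R.

Definition cosh t : R := (expR t + expR (- t)) / 2.
Definition sinh t : R := (expR t - expR (- t)) / 2.
Definition tanh t : R := sinh t / cosh t.

End Hyperbolic_functions.

Section Differentiability_classes.
Variables (R : realType) (n : nat).
Implicit Types (f : 'rV[R]_n -> R) (U : set 'rV[R]_n).

Definition partial (i : 'I_n) f (x : 'rV[R]_n) : R := 'D_(delta_mx 0 i) f x.

(* C^k on an open set: all partial derivatives of order at most k exist and are
   continuous there. *)
Fixpoint Ck (k : nat) U f : Prop :=
  (forall x, U x -> {for x, continuous f}) /\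
  match k with
  | 0 => True
  | k'.+1 => forall i, (forall x, U x -> derivable f x (delta_mx 0 i)) /\
                       Ck k' U (partial i f)
  end.

Definition extends_continuously U f : Prop :=
  exists g : 'rV[R]_n -> R,
    {within closure U, continuous g} /\ (forall x, U x -> g x = f x).

Fixpoint derivatives_extend (k : nat) U f : Prop :=
  extends_continuously U f /\
  match k with
  | 0 => True
  | k'.+1 => forall i, derivatives_extend k' U (partial i f)
  end.

(* C^k of the closure of an open set U.  The values of f on the boundary are
   data, those of its derivatives are obtained by continuous extension. *)
Definition Ck_closure (k : nat) U f : Prop :=
  [/\ Ck k U f, {within closure U, continuous f} & derivatives_extend k U f].

(* Value at a point x of closure U of the continuous extension to closure U
   of a function given on U. *)
Definition extension (V : ptopologicalType) U (F : 'rV[R]_n -> V)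
    (x : 'rV[R]_n) : V := lim (F @ within U (nbhs x)).

(* For U bounded in a complete metric on an open subset M of 'rV_n, the closure
   of U in 'rV_n is contained in M, so closure and boundary of U in M are those
   in 'rV_n. *)
Definition boundary U : set 'rV[R]_n := closure U `\` U.

Definition is_domain U : Prop := [/\ open U, connected U & U !=set0].

(* The pairing of the differential of f at x with the tangent vector v. *)
Definition differential f (x v : 'rV[R]_n) : R :=
  \sum_i partial i f x * v 0 i.

(* U lies locally, near the boundary point x, on the negative side of a C^2
   function without critical points. *)
Definition defining_function U (x : 'rV[R]_n) (W : set 'rV[R]_n) rho : Prop :=
  [/\ open W, W x, Ck 2 W rho,
      (forall y, W y -> exists i, partial i rho y != 0) &
      (forall y, W y -> (U y <-> rho y < 0))].

Definition C2_boundary U : Prop :=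
  forall x, boundary U x -> exists W rho, defining_function U x W rho.

End Differentiability_classes.

Section Riemannian_metrics.
Variables (R : realType) (n : nat).
(* A Riemannian metric, given by its Gram matrix in the coordinates of 'rV_n,
   on a subset M of 'rV_n. *)
Variables (M : set 'rV[R]_n) (g : 'rV[R]_n -> 'M[R]_n).

Definition inner (x v w : 'rV[R]_n) : R := (v *m g x *m w^T) 0 0.

Definition curve_from_to (x y : 'rV[R]_n) (c : R -> 'rV[R]_n) : Prop :=
  [/\ (forall t, derivable c t 1), continuous (derive1 c),
      (forall t, 0 <= t <= 1 -> M (c t)), c 0 = x & c 1 = y].

Definition length (c : R -> 'rV[R]_n) : R :=
  Rintegral lebesgue_measure `[0, 1]
    (fun t => Num.sqrt (inner (c t) (derive1 c t) (derive1 c t))).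

Definition distance (x y : 'rV[R]_n) : R :=
  inf [set length c | c in curve_from_to x y].

Definition geodesic_ball (p : 'rV[R]_n) (r : R) : set 'rV[R]_n :=
  [set x | M x /\ distance p x < r].

Definition metric_bounded (U : set 'rV[R]_n) : Prop :=
  exists p C, M p /\ (forall x, U x -> distance p x <= C).

Definition christoffel (m i j : 'I_n) (x : 'rV[R]_n) : R :=
  2^-1 * \sum_q invmx (g x) m q *
    (partial i (fun y => g y q j) x + partial j (fun y => g y q i) x
     - partial q (fun y => g y i j) x).

Definition hessian (u : 'rV[R]_n -> R) (x : 'rV[R]_n) : 'M[R]_n :=
  \matrix_(i, j) (partial i (partial j u) x
                  - \sum_m christoffel m i j x * partial m u x).

Definition unit_outer_normal (U : set 'rV[R]_n) (x nu : 'rV[R]_n) : Prop :=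
  exists W rho,
    [/\ defining_function U x W rho,
        inner x nu nu = 1,
        (forall v, differential rho x v = 0 -> inner x nu v = 0) &
        0 < differential rho x nu].

End Riemannian_metrics.

Section Elementary_symmetric_functions.
Variables (R : realType) (n : nat).

Definition has_eigenvalues (A : 'M[R]_n) (lambda : 'rV[R]_n) : Prop :=
  char_poly A = \prod_i ('X - (lambda 0 i)%:P).

(* The eigenvalues, with multiplicity and in some order.  They exist for
   symmetric A. *)
Definition eigenvalues (A : 'M[R]_n) : 'rV[R]_n := xget 0 (has_eigenvalues A).

Definition S_ (m : nat) (A : 'M[R]_n) : R :=
  \sum_(I : {set 'I_n} | #|I| == m) \prod_(i in I) eigenvalues A 0 i.

End Elementary_symmetric_functions.

(* Hyperbolic space is taken in the conformal (Poincare) ball model. *)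
Section Hyperbolic_space.
Variables (R : realType) (n : nat).
Implicit Types (x : 'rV[R]_n) (u : 'rV[R]_n -> R).

(* The norm of the library on 'rV_n is the sup norm, hence this definition. *)
Definition sqnorm x : R := \sum_i x 0 i ^+ 2.

Definition hyp_space : set 'rV[R]_n := [set x | sqnorm x < 1].

Definition hyp_metric x : 'M[R]_n := (4 / (1 - sqnorm x) ^+ 2)%:M.

Definition hyp_distance : 'rV[R]_n -> 'rV[R]_n -> R :=
  distance hyp_space hyp_metric.

(* The rows form an orthonormal basis of the tangent space at x. *)
Definition hyp_frame x : 'M[R]_n := ((1 - sqnorm x) / 2)%:M.

(* D^2 u - u I in the orthonormal frame. *)
Definition hyp_hessian_sub u x : 'M[R]_n :=
  hyp_frame x *m (hessian hyp_metric u x - u x *: hyp_metric x)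
    *m (hyp_frame x)^T.

End Hyperbolic_space.

Arguments hyp_space {R n}.
Arguments hyp_metric {R n}.

(* Main.v *)
Require Import Defs.
From HB Require Import structures.
From mathcomp Require Import all_boot all_order all_algebra.
From mathcomp Require Import all_classical all_reals all_analysis.
From mathcomp Require Import ring lra.

(** Since tanh takes values in ]-1, 1[, no radius satisfies the conclusion; the
    theorem holds because no function u satisfies the hypotheses, and the proof
    derives a contradiction from them.

    Let d be the hyperbolic distance to the centre 0 of the ball model, so that
    cosh d = (1 + |x|^2) / (1 - |x|^2).  This function satisfies
    D^2 (cosh d) = (cosh d) I, so U = A cosh d - 1 satisfies D^2 U - U I = I for
    every constant A, hence the equation.  Let x be a point of the closure of
    Omega at the greatest distance r from 0, which exists because a bounded
    Omega has compact closure in the open unit ball ([metric_bounded_sqnorm]),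
    and take A = 1 / cosh r.  Then x is a boundary point and U <= 0 = u on the
    boundary of Omega, with equality at x.

    The inequality U <= u holds in all of Omega ([comparison_from_below]).
    Otherwise u - U has a negative minimum at an interior point z.  The first
    and second order conditions there say that the quadratic form of
    D^2 u - u I is bounded below by that of (1 + U(z) - u(z)) I, so all its
    eigenvalues exceed 1.  But S_m / C_n^m is strictly increasing in m when all
    eigenvalues exceed 1 ([esymf_mean_increasing]), which contradicts the
    equation ([S_quotient_neq]).

    Finally u - U is nonnegative in Omega and vanishes at x, so its derivative
    at x in the direction of the outer normal is at most 0.  The derivative of u
    there is 1 by the Neumann condition, and that of U is at most
    sinh r / cosh r = tanh r < 1 ([dot_unit_normal_lt]): contradiction.

    All computations take place in the coordinates of the ball.  Derivatives
    along a straight line t |-> x + t v are obtained from the partial derivatives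
    by [is_derive_differential]. *)

Set Implicit Arguments.
Unset Strict Implicit.
Unset Printing Implicit Defensive.

Import Order.TTheory GRing.Theory Num.Theory.
Import numFieldNormedType.Exports.

Local Open Scope classical_set_scope.
Local Open Scope ring_scope.

(** * Elementary symmetric functions of numbers greater than 1 *)

Section SymmetricFunctions.
Variables (R : realType) (n : nat).

Definition esymf (x : 'rV[R]_n) (m : nat) : R :=
  \sum_(I : {set 'I_n} | #|I| == m) \prod_(i in I) x 0 i.

Lemma ex_card m : (m <= n)%N -> exists I : {set 'I_n}, #|I| == m.
Proof.
move=> mn; exists [set widen_ord mn i | i : 'I_m].
rewrite card_imset ?card_ord//.
by move=> i j /(congr1 val) /= ij; apply: val_inj.
Qed.

(** Both sides sum prod_J x over the pairs (J, i) with #|J| = m + 1 and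
    i in J: on the right such a pair is encoded by I = J minus i. *)
Lemma esymf_double_count (x : 'rV[R]_n) m :
  m.+1%:R * esymf x m.+1 =
  \sum_(I : {set 'I_n} | #|I| == m) \sum_(i | i \notin I)
    x 0 i * \prod_(j in I) x 0 j.
Proof.
transitivity (\sum_(J : {set 'I_n} | #|J| == m.+1) \sum_(i in J)
    \prod_(j in J) x 0 j).
  rewrite mulr_sumr; apply: eq_bigr => J /eqP cJ.
  by rewrite sumr_const cJ mulr_natl.
rewrite (exchange_big_dep xpredT)//= [RHS](exchange_big_dep xpredT)//=.
apply: eq_bigr => i _.
rewrite (reindex_onto (fun I => i |: I) (fun J => J :\ i)); last first.
  by move=> J /andP[_ iJ]; rewrite finset.setD1K.
apply: eq_big => [I|I].
  apply/idP/idP.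
  - move=> /andP[/andP[cI _] /eqP eI].
    have iI : i \notin I by rewrite -eI finset.setD11.
    by rewrite iI andbT; move: cI; rewrite cardsU1 iI add1n eqSS.
  - move=> /andP[cI iI].
    by rewrite cardsU1 iI add1n eqSS cI finset.setU11 /= finset.setU1K.
move=> /andP[/andP[_ _] /eqP eI].
have iI : i \notin I by rewrite -eI finset.setD11.
by rewrite big_setU1.
Qed.

(** In the double count each factor x_i exceeds 1 and every I has n - m
    elements i outside it, so (m + 1) e_(m+1) > (n - m) e_m; the binomial
    coefficients satisfy the same relation with equality. *)
Lemma esymf_mean_lt (x : 'rV[R]_n) m : (forall i, 1 < x 0 i) -> (m < n)%N ->
  esymf x m / 'C(n, m)%:R < esymf x m.+1 / 'C(n, m.+1)%:R.
Proof.
move=> x1 mn; have x0 i : 0 < x 0 i by apply: lt_trans (x1 i).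
have C0 : 0 < 'C(n, m)%:R :> R by rewrite ltr0n bin_gt0 ltnW.
have C1 : 0 < 'C(n, m.+1)%:R :> R by rewrite ltr0n bin_gt0.
have count_lt : (n - m)%:R * esymf x m < m.+1%:R * esymf x m.+1.
  rewrite esymf_double_count mulr_sumr; apply: ltr_sum.
    apply/hasP; have [I cI] := ex_card (ltnW mn).
    by exists I; rewrite ?mem_index_enum.
  move=> I /eqP cI; rewrite -mulr_suml ltr_pM2r; last exact: prodr_gt0.
  have <- : \sum_(i | i \notin I) 1 = (n - m)%:R :> R.
    rewrite sumr_const; congr (_%:R).
    rewrite -[RHS](congr1 (subn^~ m) (card_ord n)) -cI -(finset.cardsC I) addKn.
    by apply: eq_card => i; rewrite !inE.
  apply: ltr_sum => [|i _]; last exact: x1.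
  have : (0 < #|finset.setC I|)%N.
    by rewrite -(ltn_add2l #|I|) finset.cardsC addn0 cI card_ord.
  case/card_gt0P => i; rewrite inE => iI; apply/hasP.
  by exists i; rewrite ?mem_index_enum.
rewrite ltr_pdivrMr// mulrAC ltr_pdivlMr//.
have Pm : 0 < m.+1%:R :> R by rewrite ltr0n.
have bin_step : m.+1%:R * 'C(n, m.+1)%:R = (n - m)%:R * 'C(n, m)%:R :> R.
  by rewrite -!natrM mul_bin_left.
rewrite -(ltr_pM2l Pm) mulrCA bin_step mulrCA !mulrA ltr_pM2r//.
Qed.

Lemma esymf_mean_increasing (x : 'rV[R]_n) l k : (forall i, 1 < x 0 i) ->
  (l < k)%N -> (k <= n)%N ->
  esymf x l / 'C(n, l)%:R < esymf x k / 'C(n, k)%:R.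
Proof.
move=> x1 lk; elim: k lk => // k IH.
rewrite ltnS leq_eqVlt => /orP[/eqP ->|lk] kn; first exact: esymf_mean_lt.
by apply: lt_trans (IH lk (ltnW kn)) _; exact: esymf_mean_lt.
Qed.

End SymmetricFunctions.

(** * Eigenvalues and the quadratic form *)

Section Eigenvalues.
Variables (R : realType) (n : nat).
Implicit Types (A : 'M[R]_n) (v : 'rV[R]_n).

Lemma mulmx_trE v : (v *m v^T) 0 0 = sqnorm v.
Proof. by rewrite mxE; apply: eq_bigr => i _; rewrite mxE expr2. Qed.

Lemma sqnorm_ge0 v : 0 <= sqnorm v.
Proof. by apply: sumr_ge0 => i _; exact: sqr_ge0. Qed.

Lemma sqnorm_gt0 v : v != 0 -> 0 < sqnorm v.
Proof.
move=> v0; rewrite lt_def sqnorm_ge0 andbT; apply: contra v0 => /eqP s0.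
apply/eqP/rowP => i; rewrite mxE; apply/eqP; rewrite -sqrf_eq0; apply/eqP.
exact: (psumr_eq0P (fun i _ => sqr_ge0 (v 0 i)) s0).
Qed.

(** Evaluating the form at a left eigenvector v for lambda gives
    lambda |v|^2. *)
Lemma has_eigenvalues_gt A (lam : 'rV[R]_n) c : has_eigenvalues A lam ->
  (forall v, v != 0 -> c * sqnorm v < (v *m A *m v^T) 0 0) ->
  forall i, c < lam 0 i.
Proof.
move=> Alam Ac i.
have : eigenvalue A (lam 0 i).
  rewrite eigenvalue_root_char Alam rootE horner_prod (bigD1 i)//=.
  by rewrite hornerXsubC subrr mul0r.
move=> /eigenvalueP[v vA v0].
by have := Ac v v0; rewrite vA -scalemxAl mxE mulmx_trE ltr_pM2r// sqnorm_gt0.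
Qed.

(** If the characteristic polynomial of A splits, its roots exceed 1 and the
    normalized symmetric functions are strictly increasing.  If it does not
    split, [eigenvalues A] is 0 by convention, so [S_ k A = 0] because k > 0,
    whereas the other side is positive. *)
Lemma S_quotient_neq A (l k : nat) : (l < k)%N -> (k <= n)%N ->
  (forall v, v != 0 -> sqnorm v < (v *m A *m v^T) 0 0) -> 0 < S_ l A ->
  S_ k A <> 'C(n, k)%:R / 'C(n, l)%:R * S_ l A.
Proof.
move=> lk kn A1 Sl eq_S.
have Ck : 0 < 'C(n, k)%:R :> R by rewrite ltr0n bin_gt0.
have Cl : 0 < 'C(n, l)%:R :> R.
  by rewrite ltr0n bin_gt0 (leq_trans (ltnW lk) kn).
have [[lam Alam]|Anone] := pselect (exists lam, has_eigenvalues A lam).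
  have Aeig : has_eigenvalues A (eigenvalues A) by apply: xgetPex; exists lam.
  have eig1 i : 1 < eigenvalues A 0 i.
    by apply: has_eigenvalues_gt Aeig _ i => v v0; rewrite mul1r A1.
  have := esymf_mean_increasing eig1 lk kn.
  rewrite -[esymf _ l]/(S_ l A) -[esymf _ k]/(S_ k A) eq_S.
  suff -> : 'C(n, k)%:R / 'C(n, l)%:R * S_ l A / 'C(n, k)%:R
    = S_ l A / 'C(n, l)%:R by rewrite ltxx.
  by field; rewrite !gt_eqF.
have eig0 : eigenvalues A = 0.
  by apply: xgetPN => lam Alam; apply: Anone; exists lam.
have : 0 < S_ k A by rewrite eq_S mulr_gt0// divr_gt0.
rewrite /S_ eig0 big1 ?ltxx// => I /eqP cI.
have /card_gt0P[i iI] : (0 < #|I|)%N by rewrite cI (leq_ltn_trans _ lk).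
by rewrite (bigD1 i)//= mxE mul0r.
Qed.

End Eigenvalues.

(** * Directional derivatives of C^1 functions *)

Section DirectionalDerivatives.
Variables (R : realType).

(** The two difference quotients are equal, which turns statements about
    directional derivatives into one-variable calculus and back. *)
Lemma is_derive_lineP (V W : normedModType R) (f : V -> W) (y e : V) (s : R) d :
  is_derive s 1 (fun t => f (y + t *: e)) d <-> is_derive (y + s *: e) e f d.
Proof.
have quotE : (fun h : R => h^-1 *: ((fun t => f (y + t *: e)) (h *: 1 + s) -
      f (y + s *: e))) =
    (fun h => h^-1 *: (f (h *: e + (y + s *: e)) - f (y + s *: e))).
  apply/funext => h; congr (_ *: (f _ - _)).
  by rewrite [h *: 1]mulr1 scalerDl addrCA.
split=> -[df <-]; split.
- by move: df; rewrite /derivable [X in cvg (X @ _)]quotE.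
- by rewrite /derive [X in _ = lim (X @ _)]quotE.
- by rewrite /derivable [X in cvg (X @ _)]quotE.
- by rewrite /derive [X in lim (X @ _) = _]quotE.
Qed.

Lemma mean_value_line (V : normedModType R) (f : V -> R) (y e : V) (a : R) :
  (forall s, `|s| <= `|a| -> derivable f (y + s *: e) e) ->
  exists2 s, `|s| <= `|a| & f (y + a *: e) - f y = a * 'D_e f (y + s *: e).
Proof.
move=> df; pose g t := f (y + t *: e).
have dg (s : R) : `|s| <= `|a| -> is_derive s 1 g ('D_e f (y + s *: e)).
  by move=> sa; apply/is_derive_lineP; apply: derivableP; exact: df.
have cg (b c : R) : (forall s, s \in `[b, c] -> `|s| <= `|a|) ->
    {within `[b, c], continuous g}.
  move=> bc; apply: derivable_within_continuous => s /bc sa.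
  by have [] := dg _ sa.
have g0 : f y = g 0 by rewrite /g scale0r addr0.
rewrite g0 -/(g a).
have [a0|a0] := leP 0 a.
  have sub s : s \in `[0, a] -> `|s| <= `|a|.
    by rewrite in_itv/= => /andP[? ?]; rewrite !ger0_norm.
  have [s si ->] := MVT_segment a0
    (fun s si => dg s (sub s (subset_itv_oo_cc si))) (cg 0 a sub).
  by rewrite subr0 mulrC; exists s; first exact: sub.
have sub s : s \in `[a, 0] -> `|s| <= `|a|.
  rewrite in_itv/= => /andP[? ?].
  by rewrite ler0_norm// ler0_norm ?lerN2// ltW.
have [s si E] := MVT_segment (ltW a0)
  (fun s si => dg s (sub s (subset_itv_oo_cc si))) (cg a 0 sub).
exists s; first exact: sub.
by rewrite -opprB E sub0r mulrN opprK mulrC.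
Qed.

(** The increment along h (v + c e) is the increment along h v followed by
    one along h c e; the mean value theorem rewrites the latter as h c times
    the derivative in direction e at a nearby point, whose limit is given by
    continuity. *)
Lemma is_derive_add_direction (V : normedModType R) (f : V -> R) (x v e : V)
    (c d : R) :
  is_derive x v f d -> (\forall y \near x, derivable f y e) ->
  {for x, continuous ('D_e f)} ->
  is_derive x (v + c *: e) f (d + c * 'D_e f x).
Proof.
move=> [dv dE] de ce.
suff q : h^-1 *: (f (h *: (v + c *: e) + x) - f x) @[h --> 0^'] -->
    d + c * 'D_e f x.
  by split; [apply/cvg_ex; exists (d + c * 'D_e f x)|exact/cvg_lim].
have qv : h^-1 *: (f (h *: v + x) - f x) @[h --> 0^'] --> d by rewrite -dE.
apply/cvgrPdist_lt => eps eps0.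
have c1 : 0 < `|c| + 1 by rewrite ltr_wpDl.
have eps1 : 0 < eps / 2 / (`|c| + 1) by rewrite !divr_gt0.
have near_x : \forall y \near x, derivable f y e /\
    `|'D_e f x - 'D_e f y| < eps / 2 / (`|c| + 1).
  near=> y; split; first by near: y.
  near: y; move/cvgrPdist_lt : ce; exact.
move: near_x => /nbhs_normP[r /= r0 xr].
(* All points visited lie within |h| K of x. *)
pose K := `|v| + `|c| * `|e| + 1.
have K0 : 0 < K by rewrite ltr_wpDl// addr_ge0// mulr_ge0.
near=> h.
have h0 : h != 0 by near: h; exact: nbhs_dnbhs_neq.
have hr : `|h| < r / K.
  near: h; apply: nbhs_dnbhs; apply/nbhs_normP => /=.
  exists (r / K); first exact: divr_gt0.
  by move=> h /=; rewrite sub0r normrN.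
have in_r (s : R) : `|s| <= `|h * c| -> `|x - (h *: v + x + s *: e)| < r.
  move=> s_le.
  rewrite distrC [X in X - x]addrAC addrK.
  rewrite (le_lt_trans (ler_normD _ _))// !normrZ.
  rewrite (@le_lt_trans _ _ (`|h| * K))//; last by rewrite -ltr_pdivlMr.
  rewrite /K !mulrDr mulr1 mulrA -normrM -addrA lerD2l ler_wpDr//.
  by rewrite ler_wpM2r.
have [s s_le E] := @mean_value_line V f (h *: v + x) e (h * c)
  (fun s s_le => (xr _ (in_r s s_le)).1).
have -> : h^-1 *: (f (h *: (v + c *: e) + x) - f x) =
    h^-1 *: (f (h *: v + x) - f x) + c * 'D_e f (h *: v + x + s *: e).
  have -> : h *: (v + c *: e) + x = h *: v + x + (h * c) *: e.
    by rewrite scalerDr scalerA addrAC.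
  move/eqP : E; rewrite subr_eq => /eqP ->.
  rewrite -addrA scalerDr [LHS]addrC; congr (_ + _).
  by rewrite -mulrA; exact: mulKf.
rewrite opprD addrACA -mulrBr (le_lt_trans (ler_normD _ _))//.
rewrite [eps]splitr ltr_leD//.
  by near: h; move/cvgrPdist_lt : qv; apply; rewrite divr_gt0.
rewrite normrM (@le_trans _ _ (`|c| * (eps / 2 / (`|c| + 1))))//.
  by rewrite ler_wpM2l// ltW// (xr _ (in_r s s_le)).2.
rewrite mulrCA ger_pMr ?divr_gt0// mulrC ler_pdivrMl// mulr1.
by rewrite lerDl.
Unshelve. all: by end_near. Qed.

(** The coordinate directions are added to v one at a time. *)
Lemma is_derive_differential n (U : set 'rV[R]_n) (f : 'rV[R]_n -> R) x v :
  open U -> Ck 1 U f -> U x -> is_derive x v f (differential f x v).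
Proof.
move=> oU [cf dpf] Ux.
have der (s : seq 'I_n) : is_derive x (\sum_(i <- s) v 0 i *: delta_mx 0 i) f
    (\sum_(i <- s) v 0 i * partial i f x).
  elim: s => [|i s IH]; first rewrite !big_nil.
    by split; [exact: derivable0|exact: derive0].
  rewrite !big_cons addrC [X in is_derive _ _ _ X]addrC.
  apply: is_derive_add_direction => //.
  - near=> y; apply: (dpf i).1.
    by near: y; exact: open_nbhs_nbhs.
  - by have [_ [+ _]] := dpf i; apply.
rewrite [v in is_derive _ v]row_sum_delta.
have -> : differential f x v = \sum_i v 0 i * partial i f x.
  by apply: eq_bigr => i _; rewrite mulrC.
exact: der.
Unshelve. all: by end_near. Qed.

End DirectionalDerivatives.

(** * One-sided monotonicity and the second derivative test *)

Section SecondDerivativeTest.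
Variables (R : realType).

Lemma is_derive_neg_near_right (g : R -> R) (d : R) :
  is_derive (0 : R) 1 g d -> d < 0 ->
  \forall t \near (0 : R)^'+, g t < g 0.
Proof.
move=> [dg gd] d0.
have quot : h^-1 * (g h - g 0) @[h --> (0 : R)^'] --> d.
  rewrite -gd; apply: cvg_trans dg; apply: near_eq_cvg; near=> h.
  by rewrite /= addr0 [h *: 1]mulr1.
have quot_neg : \forall h \near (0 : R)^'+, h^-1 * (g h - g 0) < 0.
  by move/cvg_dnbhs_at_right/cvgr_lt : quot; exact.
near=> t; have t0 : 0 < t by near: t; exact: nbhs_right_gt.
rewrite -subr_lt0 -(pmulr_rlt0 _ (_ : 0 < t^-1)) ?invr_gt0//.
by near: t.
Unshelve. all: by end_near. Qed.

(** Only continuity from the right is assumed at 0, since the lemma is also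
    applied to a path that starts at a boundary point of the domain. *)
Lemma near_right_decreasing (g dg : R -> R) :
  g t @[t --> (0 : R)^'+] --> g 0 ->
  (\forall t \near (0 : R)^'+, is_derive t (1 : R) g (dg t) /\ dg t < 0) ->
  \forall t \near (0 : R)^'+, g t < g 0.
Proof.
move=> g_right [r /= r0 dg_neg]; near=> a.
have a0 : 0 < a by near: a; exact: nbhs_right_gt.
have ar : a < r by near: a; exact: nbhs_right_lt.
have dg_itv (s : R) : 0 < s -> s <= a -> is_derive s 1 g (dg s) /\ dg s < 0.
  move=> s0 sa; apply: dg_neg => //=.
  by rewrite sub0r normrN gtr0_norm// (le_lt_trans sa).
have g_cont s : 0 < s -> s <= a -> {for s, continuous g}.
  move=> s0 sa; apply: differentiable_continuous; apply/derivable1_diffP.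
  by have [[]] := dg_itv s s0 sa.
have cg : {within `[0, a], continuous g}.
  apply/continuous_within_itvP => //; split => //.
    by move=> s; rewrite in_itv/= => /andP[s0 /ltW]; exact: g_cont.
  by apply: cvg_at_left_filter; exact: g_cont.
have dgs (s : R) : s \in `]0, a[ -> is_derive s 1 g (dg s).
  by rewrite in_itv/= => /andP[s0 /ltW sa]; exact: (dg_itv s s0 sa).1.
have [s + E] := MVT a0 dgs cg; rewrite in_itv/= => /andP[s0 /ltW sa].
rewrite -subr_lt0 E subr0 pmulr_llt0//.
exact: (dg_itv s s0 sa).2.
Unshelve. all: by end_near. Qed.

(** If d < 0 then the derivative of g, which vanishes at 0, is negative just
    to the right of 0, so g falls below its minimum g 0. *)
Lemma second_derivative_test (g dg : R -> R) (d : R) :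
  (\forall t \near (0 : R), is_derive t (1 : R) g (dg t)) ->
  is_derive (0 : R) 1 dg d -> (\forall t \near (0 : R), g 0 <= g t) ->
  dg 0 = 0 /\ 0 <= d.
Proof.
move=> near_dg ddg near_min.
have dg0 : dg 0 = 0.
  have [r /= r0 Pr] := filterI near_dg near_min.
  have {}Pr t : t \in `]- r, r[ -> is_derive t 1 g (dg t) /\ g 0 <= g t.
    by rewrite in_itv/= -ltr_norml => tr; apply: Pr; rewrite /= sub0r normrN.
  have r0r : 0 \in `]- r, r[ by rewrite in_itv/= oppr_lt0 r0.
  have g0 : is_derive (0 : R) 1 g 0.
    apply: (derive1_at_min _ _ r0r) => [|t /Pr[[]]//|t /Pr[]//].
    by rewrite -subr_ge0 opprK addr_ge0 ?ltW.
  by have [[_ <-] _] := Pr 0 r0r; have [_ ->] := g0.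
split=> //; rewrite leNgt; apply/negP => d0.
have dg_neg := is_derive_neg_near_right ddg d0; rewrite dg0 in dg_neg.
have g_right : g t @[t --> (0 : R)^'+] --> g 0.
  apply: cvg_at_right_filter; apply: differentiable_continuous.
  by apply/derivable1_diffP; have [] := nbhs_singleton near_dg.
have g_lt : \forall t \near (0 : R)^'+, g t < g 0.
  apply: near_right_decreasing g_right _; apply: filterI dg_neg.
  exact: cvg_within near_dg.
have g_ge : \forall t \near (0 : R)^'+, g 0 <= g t.
  exact: cvg_within near_min.
have [t [+ g0t]] := @filter_ex _ (0 : R)^'+ _ _ (filterI g_lt g_ge).
by rewrite ltNge g0t.
Qed.

End SecondDerivativeTest.

(** * The function cosh d along lines *)

Section CoshDistance.
Variables (R : realType) (n : nat).
Implicit Types (x v : 'rV[R]_n) (t : R).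

Definition dot x v : R := \sum_i x 0 i * v 0 i.

(** The hyperbolic cosine of the distance from x to the centre of the ball. *)
Definition cosh_dist0 x : R := (1 + sqnorm x) / (1 - sqnorm x).

Lemma dot_line x v t : dot (x + t *: v) v = dot x v + t * sqnorm v.
Proof.
rewrite /dot /sqnorm mulr_sumr -big_split; apply: eq_bigr => i _ /=.
by rewrite !mxE; ring.
Qed.

Lemma sqnorm_line x v t :
  sqnorm (x + t *: v) = sqnorm x + 2 * t * dot x v + t ^+ 2 * sqnorm v.
Proof.
rewrite /dot /sqnorm !mulr_sumr -!big_split; apply: eq_bigr => i _ /=.
by rewrite !mxE; ring.
Qed.

Lemma is_derive_dot_line x v t :
  is_derive t 1 (fun t => dot (x + t *: v) v) (sqnorm v).
Proof.
under eq_fun do rewrite dot_line.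
by apply: is_derive_eq; rewrite /GRing.scale/=; ring.
Qed.

Lemma is_derive_sqnorm_line x v t :
  is_derive t 1 (fun t => sqnorm (x + t *: v)) (2 * dot (x + t *: v) v).
Proof.
under eq_fun do rewrite sqnorm_line.
rewrite dot_line.
by apply: is_derive_eq; rewrite /GRing.scale/=; ring.
Qed.

Lemma is_derive_cosh_dist0_line x v t : sqnorm (x + t *: v) < 1 ->
  is_derive t 1 (fun t => cosh_dist0 (x + t *: v))
    (4 * dot (x + t *: v) v / (1 - sqnorm (x + t *: v)) ^+ 2).
Proof.
move=> s1; have s0 : 1 - sqnorm (x + t *: v) != 0 by rewrite subr_eq0 gt_eqF.
have ds := is_derive_sqnorm_line x v t.
rewrite /cosh_dist0.
have d1 : is_derive t 1 (fun t => 1 - sqnorm (x + t *: v))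
    (- (2 * dot (x + t *: v) v)).
  by apply: is_derive_eq; rewrite add0r mul1r.
have dV := @is_deriveV _ (fun t => 1 - sqnorm (x + t *: v)) t _ 1 s0 d1.
by apply: is_derive_eq; rewrite /GRing.scale/=; field.
Qed.

Lemma is_derive2_cosh_dist0_line x v t : sqnorm (x + t *: v) < 1 ->
  is_derive t 1
    (fun t => 4 * dot (x + t *: v) v / (1 - sqnorm (x + t *: v)) ^+ 2)
    (4 * sqnorm v / (1 - sqnorm (x + t *: v)) ^+ 2 +
     16 * dot (x + t *: v) v ^+ 2 / (1 - sqnorm (x + t *: v)) ^+ 3).
Proof.
move=> s1; have s0 : 1 - sqnorm (x + t *: v) != 0 by rewrite subr_eq0 gt_eqF.
have ds := is_derive_sqnorm_line x v t.
have dd := is_derive_dot_line x v t.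
have d1 : is_derive t 1 (fun t => (1 - sqnorm (x + t *: v)) ^+ 2)
    (- (4 * (1 - sqnorm (x + t *: v)) * dot (x + t *: v) v)).
  by apply: is_derive_eq; rewrite /GRing.scale/=; ring.
have dV := @is_deriveV _ (fun t => (1 - sqnorm (x + t *: v)) ^+ 2) t _ 1
  (expf_neq0 2 s0) d1.
by apply: is_derive_eq; rewrite /GRing.scale/=; field.
Qed.

End CoshDistance.

(** * The Hessian in the ball model *)

Section HyperbolicHessian.
Variables (R : realType) (n : nat).
Implicit Types (x v : 'rV[R]_n) (u : 'rV[R]_n -> R).

Lemma dot_delta x (q : 'I_n) : dot x (delta_mx 0 q) = x 0 q.
Proof.
rewrite /dot (bigD1 q)//= big1 ?addr0 ?mxE ?eqxx ?mulr1// => i iq.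
by rewrite mxE (negbTE iq) andbF mulr0.
Qed.

Lemma partial_hyp_metric x (q i j : 'I_n) : hyp_space x ->
  partial q (fun y => hyp_metric y i j) x =
  16 * x 0 q / (1 - sqnorm x) ^+ 3 * (i == j)%:R.
Proof.
rewrite /hyp_space/= => s1.
have s0 : 1 - sqnorm x != 0 by rewrite subr_eq0 gt_eqF.
have E : (x + 0 *: delta_mx 0 q : 'rV[R]_n) = x by rewrite scale0r addr0.
pose g (y : 'rV[R]_n) := 4 / (1 - sqnorm y) ^+ 2 * (i == j)%:R.
have -> : (fun y : 'rV[R]_n => hyp_metric y i j) = g.
  by apply/funext => y; rewrite !mxE -[LHS]mulr_natr.
suff : is_derive (x + 0 *: delta_mx 0 q) (delta_mx 0 q) g
    (16 * x 0 q / (1 - sqnorm x) ^+ 3 * (i == j)%:R) by rewrite E; case.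
apply/is_derive_lineP; rewrite /g.
have ds := is_derive_sqnorm_line x (delta_mx 0 q) 0.
rewrite E dot_delta in ds.
have d1 : is_derive (0 : R) 1
    (fun t => (1 - sqnorm (x + t *: delta_mx 0 q)) ^+ 2)
    (- (4 * (1 - sqnorm x) * x 0 q)).
  by apply: is_derive_eq; rewrite E /GRing.scale/=; ring.
have s20 : (1 - sqnorm (x + 0 *: delta_mx 0 q)) ^+ 2 != 0.
  by rewrite E expf_neq0.
have dV := @is_deriveV _ (fun t => (1 - sqnorm (x + t *: delta_mx 0 q)) ^+ 2)
  0 _ 1 s20 d1.
by apply: is_derive_eq; rewrite E /GRing.scale/=; field.
Qed.

(** For a conformal metric exp(2 f) I one has
    Gamma^m_ij = f_i delta_mj + f_j delta_mi - f_m delta_ij; here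
    f = ln (2 / (1 - |x|^2)), so f_i = 2 x_i / (1 - |x|^2). *)
Lemma hyp_christoffel x (m i j : 'I_n) : hyp_space x ->
  christoffel hyp_metric m i j x = 2 / (1 - sqnorm x) *
    (x 0 i * (m == j)%:R + x 0 j * (m == i)%:R - x 0 m * (i == j)%:R).
Proof.
move=> xM; have : sqnorm x < 1 by [].
move=> s1; have s0 : 1 - sqnorm x != 0 by rewrite subr_eq0 gt_eqF.
rewrite /christoffel (bigD1 m)//= big1 ?addr0; last first.
  by move=> q qm; rewrite invmx_scalar mxE eq_sym (negbTE qm) mulr0n mul0r.
rewrite !partial_hyp_metric// invmx_scalar mxE eqxx mulr1n.
by field.
Qed.

Lemma sum_delta (f : 'I_n -> R) j : \sum_m (m == j)%:R * f m = f j.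
Proof.
rewrite (bigD1 j)//= eqxx mul1r big1 ?addr0// => m mj.
by rewrite (negbTE mj) mul0r.
Qed.

Lemma hyp_hessianE u x (i j : 'I_n) : hyp_space x ->
  hessian hyp_metric u x i j = partial i (partial j u) x -
    2 / (1 - sqnorm x) * (x 0 i * partial j u x + x 0 j * partial i u x -
      (i == j)%:R * differential u x x).
Proof.
move=> xM; rewrite mxE; congr (_ - _).
rewrite -(sum_delta (fun m => partial m u x) j).
rewrite -(sum_delta (fun m => partial m u x) i).
rewrite /differential !mulr_sumr -big_split/= -sumrB mulr_sumr.
by apply: eq_bigr => m _; rewrite hyp_christoffel//; ring.
Qed.

Lemma hyp_hessian_subE u x (i j : 'I_n) : hyp_space x ->
  hyp_hessian_sub u x i j = ((1 - sqnorm x) / 2) ^+ 2 *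
    (partial i (partial j u) x -
     2 / (1 - sqnorm x) * (x 0 i * partial j u x + x 0 j * partial i u x -
      (i == j)%:R * differential u x x)) - u x * (i == j)%:R.
Proof.
move=> xM; have : sqnorm x < 1 by [].
move=> s1; have s0 : 1 - sqnorm x != 0 by rewrite subr_eq0 gt_eqF.
rewrite /hyp_hessian_sub tr_scalar_mx mul_scalar_mx mul_mx_scalar scalerA.
rewrite mxE [in LHS]mxE hyp_hessianE//.
by rewrite !mxE -[4 / _ *+ _]mulr_natr; field.
Qed.

Lemma hyp_hessian_sub_form u x v : hyp_space x ->
  (v *m hyp_hessian_sub u x *m v^T) 0 0 = ((1 - sqnorm x) / 2) ^+ 2 *
    (\sum_j differential (partial j u) x v * v 0 j -
     2 / (1 - sqnorm x) * (2 * dot x v * differential u x v -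
       sqnorm v * differential u x x)) - u x * sqnorm v.
Proof.
move=> xM; set c := _ / 2; set k := 2 / _.
have half : \sum_i \sum_j v 0 i * v 0 j * (x 0 i * partial j u x) =
    dot x v * differential u x v.
  rewrite /dot mulr_suml; apply: eq_bigr => i _.
  by rewrite /differential mulr_sumr; apply: eq_bigr => j _; ring.
have cross : \sum_i \sum_j v 0 i * v 0 j *
    (x 0 i * partial j u x + x 0 j * partial i u x) =
    2 * dot x v * differential u x v.
  rewrite -mulrA -half mulr_natl mulr2n [X in _ + X]exchange_big -big_split/=.
  apply: eq_bigr => i _; rewrite -big_split/=.
  by apply: eq_bigr => j _; ring.
have diag : \sum_i \sum_j v 0 i * v 0 j * (i == j)%:R = sqnorm v.
  apply: eq_bigr => i _; rewrite (bigD1 i)//= eqxx big1 ?mulr1 ?addr0 ?expr2//.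
  by move=> j ji; rewrite eq_sym (negbTE ji) mulr0.
have second : \sum_i \sum_j v 0 i * v 0 j * partial i (partial j u) x =
    \sum_j differential (partial j u) x v * v 0 j.
  rewrite exchange_big/=; apply: eq_bigr => j _.
  by rewrite /differential mulr_suml; apply: eq_bigr => i _; ring.
have -> : (v *m hyp_hessian_sub u x *m v^T) 0 0 =
    \sum_i \sum_j v 0 i * v 0 j * hyp_hessian_sub u x i j.
  rewrite mxE exchange_big/=; apply: eq_bigr => j _.
  by rewrite !mxE mulr_suml; apply: eq_bigr => i _; ring.
rewrite -second -cross -diag !mulr_suml !mulr_sumr -!sumrB !mulr_sumr.
rewrite -!sumrB !mulr_sumr -!sumrB; apply: eq_bigr => i _.
rewrite !mulr_suml !mulr_sumr -!sumrB !mulr_sumr -!sumrB !mulr_sumr -!sumrB.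
by apply: eq_bigr => j _; rewrite hyp_hessian_subE// -/c -/k; ring.
Qed.

End HyperbolicHessian.

(** * Lower bound for the hyperbolic distance *)

Section HyperbolicDistance.
Variables (R : realType) (n : nat).
Implicit Types (x y v : 'rV[R]_n).

(** The square norm of x - (x.v / |v|^2) v is nonnegative. *)
Lemma dot_Cauchy_Schwarz x v : dot x v ^+ 2 <= sqnorm x * sqnorm v.
Proof.
have [->|v0] := eqVneq v 0.
  rewrite /dot big1 ?expr0n ?mulr_ge0 ?sqnorm_ge0// => i _.
  by rewrite mxE mulr0.
have s0 := sqnorm_gt0 v0.
have := sqnorm_ge0 (x + (- (dot x v / sqnorm v)) *: v).
rewrite sqnorm_line.
have -> : sqnorm x + 2 * - (dot x v / sqnorm v) * dot x v +
    (- (dot x v / sqnorm v)) ^+ 2 * sqnorm v =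
    (sqnorm x * sqnorm v - dot x v ^+ 2) / sqnorm v.
  by field; rewrite gt_eqF.
by rewrite pmulr_lge0 ?invr_gt0// subr_ge0.
Qed.

Lemma dot_hyp_space_le x v : hyp_space x -> dot x v <= Num.sqrt (sqnorm v).
Proof.
move=> xM; rewrite (le_trans (ler_norm _))// -sqrtr_sqr ler_sqrt ?sqnorm_ge0//.
rewrite (le_trans (dot_Cauchy_Schwarz x v))// ler_piMl ?sqnorm_ge0//.
exact: ltW.
Qed.

Lemma inner_hyp_metric x v : inner hyp_metric x v v =
  (2 / (1 - sqnorm x)) ^+ 2 * sqnorm v.
Proof.
rewrite /inner /hyp_metric mul_mx_scalar -scalemxAl mxE mulmx_trE.
by rewrite expr_div_n; congr (_ / _ * _); ring.
Qed.

Lemma continuous_sumr (T : topologicalType) (I : Type) (r : seq I)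
    (f : I -> T -> R) (x : T) : (forall i, {for x, continuous (f i)}) ->
  {for x, continuous (fun z => \sum_(i <- r) f i z)}.
Proof.
move=> cf; exact: (@cvg_big _ _ _ _ xpredT (@add_continuous _) _ (nbhs x) _ f
  (fun i => f i x) _ (fun i _ => cf i)).
Qed.

Lemma sqnorm_continuous : continuous (@sqnorm R n).
Proof.
move=> x; apply: continuous_sumr => i.
apply: (@continuous_comp _ _ _ (fun y : 'rV[R]_n => y 0 i) (fun r => r ^+ 2)).
  exact: coord_continuous.
exact: exprn_continuous.
Qed.

Section Curve.
Variables (x y : 'rV[R]_n) (c : R -> 'rV[R]_n).
Hypothesis curve_c : curve_from_to hyp_space x y c.

Let c_in t : t \in `[0, 1] -> sqnorm (c t) < 1.
Proof.
by case: curve_c => _ _ cM _ _; rewrite in_itv/=; exact: cM.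
Qed.

Let speed t := 2 / (1 - sqnorm (c t)) * Num.sqrt (sqnorm (derive1 c t)).

Let slope t := 2 / (1 - sqnorm (c t)) * dot (c t) (derive1 c t).

Let c_continuous : continuous c.
Proof.
case: curve_c => dc _ _ _ _ t.
by apply: differentiable_continuous; exact/derivable1_diffP.
Qed.

Let coef_continuous t : t \in `[0, 1] ->
  {for t, continuous (fun t => 2 / (1 - sqnorm (c t)))}.
Proof.
move=> /c_in s1; apply: cvgM; first exact: cvg_cst.
apply: cvgV; first by rewrite subr_eq0 gt_eqF.
apply: cvgB; first exact: cvg_cst.
apply: (@continuous_comp _ _ _ c (@sqnorm R n)); first exact: c_continuous.
exact: sqnorm_continuous.
Qed.

Let speed_continuous : {within `[0, 1], continuous speed}.
Proof.
apply: continuous_in_subspaceT => t; rewrite inE/= => t01.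
apply: cvgM; first exact: coef_continuous.
apply: (@continuous_comp _ _ _ (fun t => sqnorm (derive1 c t)) Num.sqrt);
  last exact: sqrt_continuous.
apply: (@continuous_comp _ _ _ (derive1 c) (@sqnorm R n));
  last exact: sqnorm_continuous.
by case: curve_c => _ + _ _ _; exact.
Qed.

Let slope_continuous : {within `[0, 1], continuous slope}.
Proof.
apply: continuous_in_subspaceT => t; rewrite inE/= => t01.
apply: cvgM; first exact: coef_continuous.
apply: (@continuous_sumr _ _ _ (fun i t => c t 0 i * derive1 c t 0 i)) => i.
apply: cvgM.
  apply: (@continuous_comp _ _ _ c (fun v : 'rV[R]_n => v 0 i)).
    exact: c_continuous.
  exact: coord_continuous.
apply: (@continuous_comp _ _ _ (derive1 c) (fun v : 'rV[R]_n => v 0 i)).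
  by case: curve_c => _ + _ _ _; exact.
exact: coord_continuous.
Qed.

Let is_derive_potential (t : R) : t \in `[0, 1] ->
  is_derive t 1 (fun t => - ln (1 - sqnorm (c t))) (slope t).
Proof.
move=> /c_in s1.
have dc i : is_derive t 1 (fun t => c t 0 i) (derive1 c t 0 i).
  have dct : derivable c t 1 by case: curve_c.
  split; first exact: (derivable_mxP _ _ _).1.
  by rewrite derive1E (derive_mx dct) mxE.
have ds : is_derive t 1 (fun t => sqnorm (c t)) (2 * dot (c t) (derive1 c t)).
  have -> : (fun t => sqnorm (c t)) = \sum_i (fun t => c t 0 i ^+ 2).
    by apply/funext => z; rewrite fct_sumE.
  have -> : 2 * dot (c t) (derive1 c t) =
      \sum_i (2 * c t 0 i * derive1 c t 0 i).
    by rewrite /dot mulr_sumr; apply: eq_bigr => i _; rewrite mulrA.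
  apply: is_derive_sum => i.
  by apply: is_derive_eq; rewrite /GRing.scale/=; ring.
have s0 : 0 < 1 - sqnorm (c t) by rewrite subr_gt0.
have d1 : is_derive t 1 (fun t => 1 - sqnorm (c t))
    (- (2 * dot (c t) (derive1 c t))).
  by apply: is_derive_eq; rewrite add0r mul1r.
have dl := @is_derive1_comp _ (@ln R) (fun t => 1 - sqnorm (c t)) t _ _
  (is_derive1_ln s0) d1.
have dn := is_deriveN dl.
by apply: is_derive_eq; rewrite /slope; field; rewrite gt_eqF.
Qed.

(** The function - ln (1 - |x|^2) is 1-Lipschitz for the hyperbolic metric:
    its derivative along the curve is 2 (c.c') / (1 - |c|^2), which is at most
    the speed 2 |c'| / (1 - |c|^2) because |c| < 1.  Unlike d itself, it is
    smooth at 0. *)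
Lemma length_ge_ln :
  ln (1 - sqnorm x) - ln (1 - sqnorm y) <= length hyp_metric c.
Proof.
have dpot (t : R) : t \in `[0, 1] ->
  derivable (fun t => - ln (1 - sqnorm (c t))) t 1.
  by case/is_derive_potential.
have compact01 : compact `[0 : R, 1] by exact: segment_compact.
have -> : length hyp_metric c = Rintegral lebesgue_measure `[0, 1] speed.
  apply: eq_Rintegral => t; rewrite inE/= => /c_in s1.
  rewrite inner_hyp_metric sqrtrM ?sqr_ge0// sqrtr_sqr ger0_norm//.
  by rewrite divr_ge0// subr_ge0 ltW.
have <- : Rintegral lebesgue_measure `[0, 1] slope =
    ln (1 - sqnorm x) - ln (1 - sqnorm y).
  have [_ _ _ c0 c1] := curve_c.
  rewrite /Rintegral.
  rewrite (@continuous_FTC2 _ _ (fun t => - ln (1 - sqnorm (c t))))//=.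
  - by rewrite c0 c1 opprK addrC.
  - have /derivable_within_continuous cpot := dpot.
    have [_ cpot0 cpot1] := (continuous_within_itvP _ ltr01).1 cpot.
    split => // t /subset_itv_oo_cc; exact: dpot.
  - by move=> t /subset_itv_oo_cc /is_derive_potential[_ <-]; rewrite derive1E.
apply: le_Rintegral => //.
- exact: continuous_compact_integrable.
- exact: continuous_compact_integrable.
- move=> t /= t01; rewrite /slope /speed ler_wpM2l//.
    by rewrite divr_ge0// subr_ge0 ltW// c_in.
  by apply: dot_hyp_space_le; exact: c_in.
Qed.

End Curve.

Lemma hyp_space_convex x y t : hyp_space x -> hyp_space y -> 0 <= t <= 1 ->
  hyp_space (x + t *: (y - x)).
Proof.
rewrite /hyp_space/= => x1 y1 /andP[t0 t1].
have -> : sqnorm (x + t *: (y - x)) = (1 - t) * sqnorm x + t * sqnorm y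
    - t * (1 - t) * sqnorm (y - x).
  rewrite /sqnorm !mulr_sumr -big_split -sumrB; apply: eq_bigr => i _ /=.
  by rewrite !mxE; ring.
rewrite ltrBlDr (@lt_le_trans _ _ 1)//; last first.
  by rewrite lerDl !mulr_ge0 ?sqnorm_ge0// subr_ge0.
have [->|tn0] := eqVneq t 0; first by rewrite subr0 mul1r mul0r addr0.
have {}t0 : 0 < t by rewrite lt_def tn0.
rewrite [ltRHS](_ : 1 = (1 - t) * 1 + t * 1); last by ring.
by rewrite ler_ltD ?ler_wpM2l ?ltr_pM2l ?subr_ge0// ltW.
Qed.

(** The infimum of an empty set of lengths would be 0; the segment shows that
    the set of lengths is not empty. *)
Lemma segment_curve x y : hyp_space x -> hyp_space y ->
  curve_from_to hyp_space x y (fun t => x + t *: (y - x)).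
Proof.
move=> xM yM.
have d (t : R) : is_derive t 1 (fun t : R => x + t *: (y - x)) (y - x).
  by apply/(is_derive_lineP id); exact: is_derive_id.
split.
- by move=> t; case: (d t).
- have -> : derive1 (fun t : R => x + t *: (y - x)) = cst (y - x).
    by apply/funext => t; rewrite derive1E; case: (d t).
  by move=> t; exact: cvg_cst.
- by move=> t; exact: hyp_space_convex.
- by rewrite scale0r addr0.
- by rewrite scale1r addrC subrK.
Qed.

Lemma hyp_distance_ge_ln x y : hyp_space x -> hyp_space y ->
  ln (1 - sqnorm x) - ln (1 - sqnorm y) <= hyp_distance x y.
Proof.
move=> xM yM; apply: lb_le_inf.
  by exists (length hyp_metric (fun t => x + t *: (y - x)));
    exists (fun t => x + t *: (y - x)) => //; exact: segment_curve.
by move=> _ [c cxy <-]; exact: length_ge_ln.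
Qed.

(** A bound on the distance from p bounds - ln (1 - |x|^2) from above, hence
    keeps x away from the unit sphere. *)
Lemma metric_bounded_sqnorm (U : set 'rV[R]_n) : U `<=` hyp_space ->
  metric_bounded hyp_space hyp_metric U ->
  exists2 a : R, a < 1 & forall x, closure U x -> sqnorm x <= a.
Proof.
move=> UM [p [C [pM UC]]].
(* Solving - ln (1 - |x|^2) + ln (1 - |p|^2) <= C for |x|^2. *)
pose a := 1 - expR (ln (1 - sqnorm p) - C).
exists a; first by rewrite ltrBlDr ltrDl expR_gt0.
have Ua : U `<=` [set x | sqnorm x <= a].
  move=> x Ux /=; have xM := UM x Ux.
  have ln_le : ln (1 - sqnorm p) - C <= ln (1 - sqnorm x).
    by rewrite lerBlDr -lerBlDl (le_trans _ (UC x Ux))// hyp_distance_ge_ln.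
  rewrite -ler_expR [leRHS]lnK ?posrE ?subr_gt0// in ln_le.
  by rewrite /a lerBrDl addrC -lerBrDl.
have closed_a : closed [set x : 'rV[R]_n | sqnorm x <= a].
  apply: (@preimage_closed _ _ (@sqnorm R n) [set r | r <= a]).
    by move=> x _; exact: sqnorm_continuous.
  exact: closed_le.
by move=> x /(closureS Ua); rewrite -((closure_id _).1 closed_a).
Qed.

End HyperbolicDistance.

(** * Continuity of the Hessian and values of extensions *)

Section Extension.
Variables (R : realType) (n : nat).
Implicit Types (U : set 'rV[R]_n) (f u : 'rV[R]_n -> R) (x v : 'rV[R]_n).

Lemma Ck_continuous k U f x : Ck k U f -> U x -> {for x, continuous f}.
Proof. by case: k => [|k] [cf _] Ux; exact: cf. Qed.

Lemma Ck_partial k U f i : Ck k.+1 U f -> Ck k U (partial i f).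
Proof. by move=> [_ /(_ i)[]]. Qed.

Lemma Ck_pred k U f : Ck k.+1 U f -> Ck k U f.
Proof.
elim: k f => [|k IH] f [cf df]; split => // i.
by have [dfi /IH] := df i; split.
Qed.

Lemma extension_interior (V : ptopologicalType) U (F : 'rV[R]_n -> V) x :
  hausdorff_space V -> open U -> U x -> {for x, continuous F} ->
  extension U F x = F x.
Proof.
move=> hV oU Ux cF; rewrite /extension within_interior; last first.
  by move: oU; rewrite openE; exact.
exact: cvg_lim.
Qed.

Lemma continuous_mx (T : topologicalType) (m p : nat) (F : T -> 'M[R]_(m, p))
    (t : T) : (forall i j, {for t, continuous (fun y => F y i j)}) ->
  {for t, continuous F}.
Proof.
move=> cF; apply/cvgrPdist_le => /= e e0; near=> y.
rewrite /Num.Def.normr/= mx_normrE (bigmax_le _ (ltW e0))//= => i _.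
rewrite !mxE/=; move: i; near: y; apply: filter_forall => /= i.
by have /cvgrPdist_le := cF i.1 i.2; exact.
Unshelve. all: by end_near. Qed.

(** By the explicit formula the entries are continuous functions of x and of
    the derivatives of u of order at most 2. *)
Lemma hyp_hessian_sub_continuous U u x : open U -> U `<=` hyp_space ->
  Ck 2 U u -> U x -> {for x, continuous (hyp_hessian_sub u)}.
Proof.
move=> oU UM u2 Ux; apply: continuous_mx => i j.
have xM := UM x Ux.
have cu := Ck_continuous u2 Ux.
have cp m : {for x, continuous (partial m u)}.
  exact: Ck_continuous (Ck_partial m u2) Ux.
have cpp : {for x, continuous (partial i (partial j u))}.
  exact: Ck_continuous (Ck_partial i (Ck_partial j u2)) Ux.
have cs : {for x, continuous (fun y => 1 - sqnorm y)}.
  by apply: continuousB; [exact: cst_continuous|exact: sqnorm_continuous].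
have cx m : {for x, continuous (fun y : 'rV[R]_n => y 0 m)}.
  exact: coord_continuous.
have cd : {for x, continuous (fun y => differential u y y)}.
  apply: (@continuous_sumr _ _ _ _ (fun m y => partial m u y * y 0 m)) => m.
  by apply: continuousM; [exact: cp|exact: cx].
pose G y := ((1 - sqnorm y) / 2) ^+ 2 *
    (partial i (partial j u) y -
     2 / (1 - sqnorm y) * (y 0 i * partial j u y + y 0 j * partial i u y -
      (i == j)%:R * differential u y y)) - u y * (i == j)%:R.
apply: (@cvg_trans _ (G y @[y --> x])).
  apply: (@near_eq_cvg _ _ (nbhs x)); near=> y.
  rewrite /G -hyp_hessian_subE//; apply: UM.
  by near: y; exact: open_nbhs_nbhs.
have GE : hyp_hessian_sub u x i j = G x by rewrite hyp_hessian_subE.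
rewrite GE -/(continuous_at x G) /G {G GE}.
have cpq a b : {for x, continuous (fun y : 'rV[R]_n => y 0 a * partial b u y)}.
  by apply: continuousM; [exact: cx|exact: cp].
have s0 : 1 - sqnorm x != 0 by rewrite subr_eq0 gt_eqF.
have cc (r : R) : {for x, continuous (fun _ : 'rV[R]_n => r)}.
  exact: cst_continuous.
have cfactor := continuousM cs (cc 2^-1).
have cgamma := continuousM (cc 2)
  (@continuousV _ _ (fun y : 'rV[R]_n => 1 - sqnorm y) x s0 cs).
have cgrad := continuousB (continuousD (cpq i j) (cpq j i))
  (continuousM (cc (i == j)%:R) cd).
exact: continuousB (continuousM (continuousM cfactor cfactor)
  (continuousB cpp (continuousM cgamma cgrad))) (continuousM cu (cc _)).
Unshelve. all: by end_near. Qed.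

Lemma extension_hyp_hessian_sub U u x : open U -> U `<=` hyp_space ->
  Ck 2 U u -> U x -> extension U (hyp_hessian_sub u) x = hyp_hessian_sub u x.
Proof.
move=> oU UM u2 Ux; have mx_hausdorff : hausdorff_space 'M[R]_n.
  exact: norm_hausdorff.
apply: (extension_interior mx_hausdorff oU Ux).
exact: hyp_hessian_sub_continuous u2 Ux.
Qed.

End Extension.

(** * Comparison with a multiple of cosh d *)

Section Comparison.
Variables (R : realType) (n : nat).
Implicit Types (U : set 'rV[R]_n) (u : 'rV[R]_n -> R) (x v z : 'rV[R]_n).

Lemma line_continuous x v : continuous (fun t : R => x + t *: v).
Proof.
move=> t; apply: differentiable_continuous; apply/derivable1_diffP.
by have [] := (is_derive_lineP id x v t v).2 (is_derive_id _ _).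
Qed.

Lemma near_line U x v : open U -> U x ->
  \forall t \near (0 : R), U (x + t *: v).
Proof.
move=> oU Ux; have cl := @line_continuous x v 0.
apply: cl; rewrite scale0r addr0; exact: open_nbhs_nbhs.
Qed.

(** At a minimum z of u - A cosh d the derivatives along every line satisfy
    the first and second order conditions.  By the first, du(z) may be replaced
    by the differential of A cosh d in the Christoffel terms; by the second, the
    form dominates the one obtained from D^2 (A cosh d) = (A cosh d) I. *)
Lemma hyp_hessian_sub_form_ge U u z A : open U -> U `<=` hyp_space ->
  Ck 2 U u -> U z ->
  (\forall y \near z, u z - A * cosh_dist0 z <= u y - A * cosh_dist0 y) ->
  forall v, (A * cosh_dist0 z - u z) * sqnorm v <=
    (v *m hyp_hessian_sub u z *m v^T) 0 0.
Proof.
move=> oU UM u2 Uz min_z.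
have zM := UM z Uz.
have z0 v : z + 0 *: v = z by rewrite scale0r addr0.
have s0 : 1 - sqnorm z != 0 by rewrite subr_eq0 gt_eqF.
have along v : differential u z v = A * (4 * dot z v / (1 - sqnorm z) ^+ 2) /\
    0 <= \sum_j differential (partial j u) z v * v 0 j -
      A * (4 * sqnorm v / (1 - sqnorm z) ^+ 2 +
           16 * dot z v ^+ 2 / (1 - sqnorm z) ^+ 3).
  pose q' (t : R) := 4 * dot (z + t *: v) v / (1 - sqnorm (z + t *: v)) ^+ 2.
  pose g (t : R) := u (z + t *: v) - A * cosh_dist0 (z + t *: v).
  pose dg (t : R) := differential u (z + t *: v) v - A * q' t.
  have near_U := near_line v oU Uz.
  have dg_near : \forall t \near (0 : R), is_derive t (1 : R) g (dg t).
    near=> t; have Ut : U (z + t *: v) by near: t.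
    have du := (is_derive_lineP u z v t _).2
      (is_derive_differential v oU (Ck_pred u2) Ut).
    have dq := is_derive_cosh_dist0_line (UM _ Ut).
    by apply: is_derive_eq.
  have ddg : is_derive (0 : R) 1 dg
      (\sum_j differential (partial j u) z v * v 0 j -
        A * (4 * sqnorm v / (1 - sqnorm z) ^+ 2 +
             16 * dot z v ^+ 2 / (1 - sqnorm z) ^+ 3)).
    have sM : sqnorm (z + 0 *: v) < 1 by rewrite z0.
    have := is_derive2_cosh_dist0_line sM; rewrite z0 => dq'.
    have dpu j : is_derive (0 : R) 1 (fun t => partial j u (z + t *: v))
        (differential (partial j u) z v).
      apply/is_derive_lineP; rewrite z0.
      exact: is_derive_differential oU (Ck_partial j u2) Uz.
    have ddu : is_derive (0 : R) 1 (fun t => differential u (z + t *: v) v)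
        (\sum_j differential (partial j u) z v * v 0 j).
      have -> : (fun t : R => differential u (z + t *: v) v) =
          \sum_j (fun t => partial j u (z + t *: v) * v 0 j).
        by apply/funext => t; rewrite fct_sumE.
      apply: is_derive_sum => j.
      by apply: is_derive_eq; rewrite /GRing.scale/=; ring.
    by apply: is_derive_eq.
  have g_min : \forall t \near (0 : R), g 0 <= g t.
    have min_z0 : nbhs (z + 0 *: v)
        [set y | u z - A * cosh_dist0 z <= u y - A * cosh_dist0 y].
      by rewrite z0.
    by rewrite /g z0; exact: (@line_continuous z v 0 _ min_z0).
  have [dg0 ddg0] := second_derivative_test dg_near ddg g_min.
  split=> //; by move/eqP: dg0; rewrite /dg /q' z0 subr_eq0 => /eqP.
move=> v; have [grad_v second_v] := along v; have [grad_z _] := along z.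
rewrite hyp_hessian_sub_form// grad_v grad_z -subr_ge0.
have dot_zz : dot z z = sqnorm z by apply: eq_bigr => i _; rewrite expr2.
set D2 := \sum_j _ in second_v *.
rewrite dot_zz (_ : _ - _ = ((1 - sqnorm z) / 2) ^+ 2 *
  (D2 - A * (4 * sqnorm v / (1 - sqnorm z) ^+ 2 +
             16 * dot z v ^+ 2 / (1 - sqnorm z) ^+ 3))).
  by rewrite mulr_ge0// sqr_ge0.
by rewrite /cosh_dist0; field.
Unshelve. all: by end_near. Qed.

Lemma cosh_dist0_continuous x : hyp_space x ->
  {for x, continuous (@cosh_dist0 R n)}.
Proof.
move=> xM; have s0 : 1 - sqnorm x != 0 by rewrite subr_eq0 gt_eqF.
have cs := @sqnorm_continuous R n x.
have c1 : {for x, continuous (fun _ : 'rV[R]_n => 1 : R)}.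
  exact: cst_continuous.
have cV := @continuousV _ _ (fun y : 'rV[R]_n => 1 - sqnorm y) x s0
  (continuousB c1 cs).
exact: continuousM (continuousD c1 cs) cV.
Qed.

(** At a minimum of u - A cosh d with value below -1 the coefficient
    A cosh d - u exceeds 1, so by [hyp_hessian_sub_form_ge] all eigenvalues of
    D^2 u - u I exceed 1. *)
Lemma comparison_from_below (l k : nat) U u A :
  (l < k)%N -> (k <= n)%N -> open U -> U !=set0 -> U `<=` hyp_space ->
  compact (closure U) -> closure U `<=` hyp_space -> Ck 2 U u ->
  {within closure U, continuous u} ->
  (forall x, U x -> S_ k (hyp_hessian_sub u x) =
    'C(n, k)%:R / 'C(n, l)%:R * S_ l (hyp_hessian_sub u x)) ->
  (forall x, U x -> 0 < S_ l (hyp_hessian_sub u x)) ->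
  (forall x, boundary U x -> A * cosh_dist0 x - 1 <= u x) ->
  forall x, closure U x -> A * cosh_dist0 x - 1 <= u x.
Proof.
move=> lk kn oU [x0 Ux0] UM cU cUM u2 uc u_eq Sl bdry.
pose w y := u y - A * cosh_dist0 y.
have wc : {within closure U, continuous w}.
  apply/subspace_continuousP => y cUy.
  have cq := cosh_dist0_continuous (cUM y cUy).
  have cuy := (subspace_continuousP _ u).1 uc y cUy.
  have cqA : A * cosh_dist0 z @[z --> within (closure U) (nbhs y)] -->
      A * cosh_dist0 y.
    apply: (@cvg_within_filter _ _ (fun z => A * cosh_dist0 z)).
    exact: continuousM (@cst_continuous _ _ A y) cq.
  exact: cvgB cuy cqA.
have cU0 : closure U !=set0 by exists x0; exact: subset_closure.
have [z + min_z] := EVT_min_rV cU0 cU wc.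
rewrite inE => cUz.
suff w_ge : -1 <= w z.
  move=> x cUx; have := le_trans w_ge (min_z x (mem_set cUx)).
  by rewrite /w lerBrDr addrC.
have [Uz|nUz] := pselect (U z); last first.
  by have := bdry z (conj cUz nUz); rewrite /w lerBrDr addrC.
rewrite leNgt; apply/negP => w_lt.
apply: (S_quotient_neq lk kn _ (Sl z Uz) (u_eq z Uz)) => v v0.
have form_ge : (A * cosh_dist0 z - u z) * sqnorm v <=
    (v *m hyp_hessian_sub u z *m v^T) 0 0.
  apply: (hyp_hessian_sub_form_ge oU UM u2 Uz); near=> y.
  apply: min_z; rewrite inE; apply: subset_closure.
  by near: y; exact: open_nbhs_nbhs.
apply: lt_le_trans form_ge.
by rewrite ltr_pMl ?sqnorm_gt0// -opprB ltrNr.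
Unshelve. all: by end_near. Qed.

End Comparison.

(** * Behaviour along the inner normal *)

Section Boundary.
Variables (R : realType) (n : nat).
Implicit Types (U : set 'rV[R]_n) (u : 'rV[R]_n -> R) (x v : 'rV[R]_n).

Lemma sqnorm_bounded U (a : R) : (forall x, U x -> sqnorm x <= a) ->
  bounded_set U.
Proof.
move=> Ua; exists (a + 1); split; first exact: num_real.
move=> M aM x Ux; rewrite /= /Num.Def.normr/= mx_normrE.
have a0 : 0 <= a by rewrite (le_trans (sqnorm_ge0 x))// Ua.
have M0 : 0 <= M by rewrite (le_trans _ (ltW aM))// addr_ge0.
apply: bigmax_le => // -[i j] _ /=; rewrite (ord1 i).
have xj : x 0 j ^+ 2 <= a.
  rewrite (le_trans _ (Ua x Ux))// /sqnorm (bigD1 j)//= lerDl.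
  by apply: sumr_ge0 => m _; exact: sqr_ge0.
rewrite -[leRHS]ger0_norm// -ler_sqr ?nnegrE// !real_normK ?num_real//.
nra.
Qed.

(** The restriction of |x|^2 to a line has second derivative 2 |v|^2 > 0, so it
    has no local maximum. *)
Lemma sqnorm_max_notin U x : (0 < n)%N -> open U ->
  (forall y, U y -> sqnorm y <= sqnorm x) -> ~ U x.
Proof.
move=> n0 oU x_max Ux; pose v : 'rV[R]_n := delta_mx 0 (Ordinal n0).
have v1 : sqnorm v = 1.
  rewrite /sqnorm (bigD1 (Ordinal n0))//= big1 ?mxE ?eqxx ?addr0 ?expr1n//.
  by move=> i iN; rewrite mxE (negbTE iN) andbF expr0n.
have dg : \forall t \near (0 : R), is_derive t (1 : R)
    (fun t => - sqnorm (x + t *: v)) (- (2 * dot (x + t *: v) v)).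
  by near=> t; have ds := is_derive_sqnorm_line x v t; exact: is_deriveN.
have ddg : is_derive (0 : R) 1 (fun t => - (2 * dot (x + t *: v) v)) (- 2).
  have dd := is_derive_dot_line x v 0.
  by apply: is_derive_eq; rewrite v1 /GRing.scale/=; ring.
have g_min : \forall t \near (0 : R),
    - sqnorm (x + 0 *: v) <= - sqnorm (x + t *: v).
  near=> t; rewrite scale0r addr0 lerN2 x_max//.
  by near: t; exact: near_line.
have [_] := second_derivative_test dg ddg g_min.
by rewrite oppr_ge0 leNgt ltr0n.
Unshelve. all: by end_near. Qed.

Lemma differentialN u x v : differential u x (- v) = - differential u x v.
Proof.
by rewrite /differential -sumrN; apply: eq_bigr => i _; rewrite mxE mulrN.
Qed.

(** A defining function rho is at most 0 at the boundary point, and its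
    derivative along - nu is negative. *)
Lemma inner_normal_near U x nu (g : 'rV[R]_n -> 'M[R]_n) : boundary U x ->
  unit_outer_normal g U x nu ->
  \forall t \near (0 : R)^'+, U (x + t *: - nu).
Proof.
move=> [cUx _] [W [rho [[oW Wx rho2 _ Urho] _ _ dnu]]].
have rho1 := Ck_pred rho2.
have crho := Ck_continuous rho1 Wx.
have rho_le0 : rho x <= 0.
  rewrite leNgt; apply/negP => rho_gt0.
  have /cUx[y [Uy [rho_y Wy]]] : nbhs x [set y | 0 < rho y /\ W y].
    near=> y; split; last by near: y; exact: open_nbhs_nbhs.
    by near: y; move/cvgr_gt : crho; exact.
  by move: (Urho y Wy) => [/(_ Uy)]; rewrite ltNge (ltW rho_y).
have drho : is_derive (0 : R) 1 (fun t => rho (x + t *: - nu))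
    (differential rho x (- nu)).
  apply/is_derive_lineP; rewrite scale0r addr0.
  exact: is_derive_differential oW rho1 Wx.
have drho_neg : differential rho x (- nu) < 0.
  by rewrite differentialN oppr_lt0.
have := is_derive_neg_near_right drho drho_neg.
rewrite scale0r addr0 => rho_lt; near=> t; apply/Urho.
  near: t; apply: cvg_within; exact: near_line.
apply: lt_le_trans rho_le0; near: t; exact: rho_lt.
Unshelve. all: by end_near. Qed.

Lemma cvg_line_within U x v :
  (\forall t \near (0 : R)^'+, U (x + t *: v)) ->
  x + t *: v @[t --> (0 : R)^'+] --> within U (nbhs x).
Proof.
move=> Uv P /= UP.
have near_P : \forall t \near (0 : R)^'+, U (x + t *: v) -> P (x + t *: v).
  apply: cvg_within; have UP0 : nbhs (x + 0 *: v) (fun y => U y -> P y).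
    by rewrite scale0r addr0.
  exact: (@line_continuous R n x v 0 _ UP0).
exact: filterS2 (fun t Ut UPt => UPt Ut) Uv near_P.
Qed.

(** Each partial derivative has a continuous extension, so the limit that
    defines [extension] is a genuine limit. *)
Lemma extension_differential k U u x v : closure U x ->
  derivatives_extend k.+1 U u ->
  differential u y v @[y --> within U (nbhs x)] -->
    extension U (fun y => differential u y v) x.
Proof.
move=> cUx [_ dU].
have dlim i : exists l : R, partial i u y @[y --> within U (nbhs x)] --> l.
  have [g [gc gU]] : extends_continuously U (partial i u).
    by case: k dU => [|k] /(_ i)[].
  exists (g x).
  have gx := (subspace_continuousP _ g).1 gc x cUx.
  apply: (@cvg_trans _ (g y @[y --> within U (nbhs x)])).
    apply: (@near_eq_cvg _ _ (within U (nbhs x))).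
    by rewrite near_withinE; apply: nearW => y Uy; exact: gU.
  apply: cvg_trans gx; apply: cvg_app; apply: within_subset.
  exact: subset_closure.
have [l dl] := choice dlim.
have proper_U : ProperFilter (within U (nbhs x)) by exact: within_nbhs_proper.
have d_cvg : differential u y v @[y --> within U (nbhs x)] -->
    \sum_i l i * v 0 i.
  apply: (@cvg_big _ _ _ _ xpredT (@add_continuous _) _ (within U (nbhs x)) _
    (fun i y => partial i u y * v 0 i) (fun i => l i * v 0 i)) => i _.
  by apply: cvgM; [exact: dl|exact: cvg_cst].
rewrite /extension (cvg_lim _ d_cvg)//.
Qed.

End Boundary.

(** * The contradiction at a farthest boundary point *)

(** This is the estimate tanh r < 1: by Cauchy-Schwarz and the normalization
    |nu| = (1 - |x|^2) / 2, the quotient of the two sides is at most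
    2 |x| / (1 + |x|^2), which is tanh of the distance from 0 to x. *)
Lemma dot_unit_normal_lt (R : realType) (n : nat) (x nu : 'rV[R]_n) :
  hyp_space x -> inner hyp_metric x nu nu = 1 ->
  4 * dot x nu < (1 - sqnorm x) * (1 + sqnorm x).
Proof.
move=> xM nu1; have s1 : 0 < 1 - sqnorm x by rewrite subr_gt0.
have s0 := sqnorm_ge0 x.
have nuE : sqnorm nu = ((1 - sqnorm x) / 2) ^+ 2.
  rewrite inner_hyp_metric in nu1.
  rewrite -[LHS]mul1r -[X in X * _](_ : ((1 - sqnorm x) / 2) ^+ 2 *
    (2 / (1 - sqnorm x)) ^+ 2 = 1); last by field; rewrite gt_eqF.
  by rewrite -mulrA nu1 mulr1.
have CS : (4 * dot x nu) ^+ 2 <= 4 * sqnorm x * (1 - sqnorm x) ^+ 2.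
  have := dot_Cauchy_Schwarz x nu; rewrite nuE; nra.
have B0 : 0 <= (1 - sqnorm x) * (1 + sqnorm x).
  by rewrite mulr_ge0 ?(ltW s1)// addr_ge0.
rewrite ltNge; apply/negP => ge_dot.
have : ((1 - sqnorm x) * (1 + sqnorm x)) ^+ 2 <= (4 * dot x nu) ^+ 2.
  by rewrite ler_sqr ?nnegrE// (le_trans B0).
apply/negP; rewrite -ltNge (le_lt_trans CS)// -subr_gt0.
rewrite (_ : _ - _ = ((1 - sqnorm x) ^+ 2) ^+ 2); last by ring.
by rewrite exprn_gt0// exprn_gt0.
Qed.

Theorem theorem1p2 (R : realType) (n k l : nat) (hlk : (l < k)%N)
    (hkn : (k <= n)%N)
    (Omega : set 'rV[R]_n) (gamma : 'rV[R]_n -> 'rV[R]_n) (u : 'rV[R]_n -> R)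
    (Omega_sub : Omega `<=` hyp_space)
    (Omega_domain : is_domain Omega)
    (Omega_bounded : metric_bounded hyp_space hyp_metric Omega)
    (Omega_C2 : C2_boundary Omega)
    (gamma_normal : forall x, boundary Omega x ->
       unit_outer_normal hyp_metric Omega x (gamma x))
    (u_C3 : Ck 3 Omega u)
    (u_C2 : Ck_closure 2 Omega u)
    (u_eq : forall x, Omega x ->
       S_ k (hyp_hessian_sub u x)
       = 'C(n, k)%:R / 'C(n, l)%:R * S_ l (hyp_hessian_sub u x))
    (u_dirichlet : forall x, boundary Omega x -> u x = 0)
    (u_neumann : forall x, boundary Omega x ->
       extension Omega (fun y => differential u y (gamma x)) x = 1)
    (Sl_pos : forall x, closure Omega x ->
       0 < S_ l (extension Omega (hyp_hessian_sub u) x)) :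
  exists (p : 'rV[R]_n) (r : R),
    [/\ hyp_space p, 0 < r, tanh r = 1,
        Omega = geodesic_ball hyp_space hyp_metric p r &
        forall x, Omega x -> u x = cosh (hyp_distance p x) / cosh r - 1].
Proof.
(* No r has tanh r = 1, so the hypotheses themselves are to be refuted. *)
exfalso.
have [oU _ U0] := Omega_domain.
have [u2 uc dext] := u_C2.
have u1 := Ck_pred u2.
have [a a1 Ua] := metric_bounded_sqnorm Omega_sub Omega_bounded.
have cUM : closure Omega `<=` hyp_space.
  by move=> x /Ua xa; exact: le_lt_trans a1.
have cU : compact (closure Omega).
  apply: bounded_closed_compact; last exact: closed_closure.
  exact: sqnorm_bounded Ua.
have cU0 : closure Omega !=set0.
  by case: U0 => y Uy; exists y; exact: subset_closure.
have sc : {within closure Omega, continuous (@sqnorm R n)}.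
  by apply: continuous_subspaceT; exact: sqnorm_continuous.
have [x + x_max] := EVT_max_rV cU0 cU sc; rewrite inE => cUx.
have {}x_max y : closure Omega y -> sqnorm y <= sqnorm x.
  by move=> cUy; exact: x_max (mem_set cUy).
have xM := cUM x cUx.
have bx : boundary Omega x.
  split=> //; apply: sqnorm_max_notin oU _.
    by apply: leq_trans hkn; exact: leq_ltn_trans hlk.
  by move=> y Uy; apply: x_max; exact: subset_closure.
(* With this constant A cosh d - 1 vanishes at x and is at most 0 elsewhere on
   the boundary. *)
pose A := (cosh_dist0 x)^-1.
have s1 : 0 < 1 - sqnorm x by rewrite subr_gt0.
have s0 := sqnorm_ge0 x.
have q0 : 0 < cosh_dist0 x by rewrite divr_gt0// ltr_wpDr.
have u_ge : forall y, closure Omega y -> A * cosh_dist0 y - 1 <= u y.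
  apply: (comparison_from_below hlk hkn oU U0 Omega_sub cU cUM u2 uc u_eq).
    move=> y Uy; rewrite -(extension_hyp_hessian_sub oU Omega_sub u2 Uy).
    exact: (Sl_pos y (subset_closure Uy)).
  move=> y by_; rewrite u_dirichlet// subr_le0 /A ler_pdivrMl// mulr1.
  have [cUy _] := by_.
  have sy1 : 0 < 1 - sqnorm y by rewrite subr_gt0; exact: cUM.
  have := x_max y cUy.
  rewrite /cosh_dist0 ler_pdivrMr// mulrAC ler_pdivlMr// => sxy.
  nra.
have [W [rho [_ nu1 _ _]]] := gamma_normal x bx.
set nu := gamma x in nu1.
have x0 : x + 0 *: - nu = x by rewrite scale0r addr0.
have near_U := inner_normal_near bx (gamma_normal x bx).
(* psi is u - (A cosh d - 1), up to a constant, along the inner normal; its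
   derivative tends to a negative number although psi is minimal at 0. *)
pose slope t := differential u (x + t *: - nu) (- nu) -
  A * (4 * dot (x + t *: - nu) (- nu) / (1 - sqnorm (x + t *: - nu)) ^+ 2).
pose psi t := u (x + t *: - nu) - A * cosh_dist0 (x + t *: - nu).
have psi_slope : \forall t \near (0 : R)^'+, is_derive t (1 : R) psi (slope t).
  near=> t; have Ut : Omega (x + t *: - nu) by near: t.
  have du := (is_derive_lineP u x (- nu) t _).2
    (is_derive_differential (- nu) oU u1 Ut).
  have dq := is_derive_cosh_dist0_line (Omega_sub _ Ut).
  by apply: is_derive_eq.
have lineU := cvg_line_within near_U.
have du_lim : differential u (x + t *: - nu) (- nu) @[t --> (0 : R)^'+] -->
    (-1 : R).
  have := cvg_comp _ _ lineU
    (@extension_differential R n _ _ _ _ nu cUx dext).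
  rewrite u_neumann// => /cvgN; apply: cvg_trans; apply: near_eq_cvg.
  by near=> t; rewrite /= differentialN.
have slope_lim : slope t @[t --> (0 : R)^'+] -->
    (-1 : R) - A * (4 * dot x (- nu) / (1 - sqnorm x) ^+ 2).
  have sM : sqnorm (x + 0 *: - nu) < 1 by rewrite x0.
  have [/derivable1_diffP/differentiable_continuous dq _] :=
    is_derive2_cosh_dist0_line sM.
  apply: cvgB du_lim _; apply: cvgM; first exact: cvg_cst.
  by have := cvg_at_right_filter dq; rewrite x0.
have slope_neg : \forall t \near (0 : R)^'+, slope t < 0.
  move/cvgr_lt : slope_lim; apply.
  have dotN : dot x (- nu) = - dot x nu.
    by rewrite /dot -sumrN; apply: eq_bigr => i _; rewrite mxE mulrN.
  rewrite dotN [ltLHS](_ : _ = (4 * dot x nu) /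
    ((1 - sqnorm x) * (1 + sqnorm x)) - 1).
    rewrite subr_lt0 ltr_pdivrMr ?mul1r; first exact: dot_unit_normal_lt.
    by rewrite mulr_gt0// ltr_wpDr.
  by rewrite /A /cosh_dist0; field; rewrite !gt_eqF// ltr_wpDr.
have psi_right : psi t @[t --> (0 : R)^'+] --> psi 0.
  have uU : u y @[y --> within Omega (nbhs x)] --> u x.
    apply: cvg_trans ((subspace_continuousP _ u).1 uc x cUx).
    by apply: cvg_app; apply: within_subset; exact: subset_closure.
  have sM : sqnorm (x + 0 *: - nu) < 1 by rewrite x0.
  have [/derivable1_diffP/differentiable_continuous dq _] :=
    is_derive_cosh_dist0_line sM.
  rewrite /psi; apply: cvgB; first by rewrite x0; exact: cvg_comp _ _ lineU uU.
  by apply: cvgM; [exact: cvg_cst|exact: cvg_at_right_filter dq].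
have psi_lt : \forall t \near (0 : R)^'+, psi t < psi 0.
  exact: near_right_decreasing psi_right (filterI psi_slope slope_neg).
have psi_ge : \forall t \near (0 : R)^'+, psi 0 <= psi t.
  near=> t; have Ut : Omega (x + t *: - nu) by near: t.
  rewrite /psi x0 u_dirichlet// mulVf ?gt_eqF// sub0r lerBrDl.
  by apply: u_ge; exact: subset_closure.
have [t [+ g0t]] := @filter_ex _ (0 : R)^'+ _ _ (filterI psi_lt psi_ge).
by rewrite ltNge g0t.
Unshelve. all: by end_near. Qed.
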